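(* There exists a randomized algorithm that, given query access to a function $f\colon\{-1,1\}^n\to\{-1,1\}$ and parameters $k\ge 1$ (an integer), $\epsilon\in(0,1)$ and $\rho\in(0,1)$, satisfies the following. (1) If $f$ is $\rho\epsilon/16$-close to some $k$-junta, then the algorithm accepts with high constant probability (at least $2/3$). (2) If $f$ is $\epsilon$-far from every $k$-junta, then the algorithm rejects with high constant probability (at least $2/3$). The query complexity of the algorithm is $O\!\left(\frac{k\log (k+1)}{\epsilon\rho(1-\rho)^k}\right)$, where the constant hidden in $O(\cdot)$ is absolute (independent of $n,f,k,\epsilon,\rho$).
   Context: For $f,g\colon\{-1,1\}^n\to\{-1,1\}$, $\mathrm{dist}(f,g)=\Pr_x[f(x)\ne g(x)]$ with $x$ uniform in $\{-1,1\}^n$. A function is a $k$-junta if it depends on at most $k$ of its variables: there is $T\subseteq[n]$, $|T|\le k$, such that $f(x)=f(y)$ whenever $x_i=y_i$ for all $i\in T$. $f$ is $\epsilon$-close to $g$ if $\mathrm{dist}(f,g)\le\epsilon$, and $\epsilon$-far from $g$ if $\mathrm{dist}(f,g)>\epsilon$. Query access means that the algorithm may adaptively request $f(x)$ for points $x\in\{-1,1\}^n$ of its choice; query complexity is the maximum number of such requests. *)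

(* Defs.v *)
From HB Require Import structures.
From mathcomp Require Import all_boot all_order all_algebra.
From mathcomp Require Import all_classical all_reals all_analysis.

Set Implicit Arguments.
Unset Strict Implicit.
Unset Printing Implicit Defensive.

Import Order.TTheory GRing.Theory Num.Theory.
Local Open Scope ring_scope.

(* The two-element set {-1,1} is encoded by bool, b standing for (-1)^b; the
   notions below only ever test values in {-1,1} for equality. *)
Definition cube (n : nat) := {ffun 'I_n -> bool}.

Definition boolfun (n : nat) := {ffun cube n -> bool}.

Definition dist (R : realType) (n : nat) (f g : boolfun n) : R :=
  #|[set x : cube n | f x != g x]|%:R / #|{: cube n}|%:R.

Definition junta (n k : nat) (f : boolfun n) : Prop :=
  exists2 T : {set 'I_n}, (#|T| <= k)%N &
    forall x y : cube n, (forall i, i \in T -> x i = y i) -> f x = f y.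

Definition eps_close (R : realType) (n : nat) (d : R) (f g : boolfun n) : Prop :=
  dist R f g <= d.

Definition eps_far (R : realType) (n : nat) (d : R) (f g : boolfun n) : Prop :=
  d < dist R f g.

(* Randomized adaptive query algorithms on functions over the n-cube, as finite
   trees. The unknown function is visible only through the answers to the
   queries. [Toss p A B] continues with A with probability p and with B with
   probability 1 - p, independently of all other tosses. [Output true] accepts
   and [Output false] rejects. *)
Inductive ralg (R : realType) (n : nat) : Type :=
| Output of bool
| Query of cube n & (bool -> ralg R n)
| Toss (p : R) of 0 <= p <= 1 & ralg R n & ralg R n.

Fixpoint prob_output (R : realType) (n : nat) (f : boolfun n) (b : bool)
    (A : ralg R n) : R :=
  match A with
  | Output c => (c == b)%:R
  | Query x next => prob_output f b (next (f x))
  | Toss p _ A1 A2 => p * prob_output f b A1 + (1 - p) * prob_output f b A2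
  end.

Definition prob_accept (R : realType) (n : nat) (A : ralg R n) (f : boolfun n) :=
  prob_output f true A.

Definition prob_reject (R : realType) (n : nat) (A : ralg R n) (f : boolfun n) :=
  prob_output f false A.

(* Largest number of queries made on input f over all outcomes of the tosses. *)
Fixpoint num_queries (R : realType) (n : nat) (f : boolfun n)
    (A : ralg R n) : nat :=
  match A with
  | Output _ => 0
  | Query x next => (num_queries f (next (f x))).+1
  | Toss _ _ A1 A2 => maxn (num_queries f A1) (num_queries f A2)
  end.

Definition query_complexity (R : realType) (n : nat) (A : ralg R n) : nat :=
  \max_(f : boolfun n) num_queries f A.

(* Main.v *)
Require Import Defs.
From HB Require Import structures.
From mathcomp Require Import all_boot all_order all_algebra.
From mathcomp Require Import all_classical all_reals all_analysis.
From mathcomp Require Import ring lra zify.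

(* The influence I(S) = Pr[f x != f (mix S x y)] of a set S of variables is
   sum_{U meets S} w U for a nonnegative weight w on sets (the squared Fourier
   coefficients), hence monotone and subadditive. If f is d-close to a T-junta
   then I(S) <= 2 d for S disjoint from T; if f is eps-far from every k-junta
   then I(~: T) > eps whenever #|T| <= k.

   Put the variables at random into l = 100 k^2 parts. If f is eps-far, then
   with probability 5/6 every union J of k parts has I(~: J) >= eps / 4. Indeed,
   call J bad if not. Either some S with #|S| < 2k has I(~: S) < eps / 2; if the
   parts separate S, a bad J gives #|S :&: J| <= k and I(~: (S :&: J)) < eps,
   which is impossible. Or all sets of size < 2k leave out mass eps / 2; then a
   greedy choice yields T with #|T| >= 2k that lies in at least a fraction
   2^-2k of the bad outcomes, and T lies in a given union of k parts only with
   probability (k/l)^#|T|, which beats the union bound over the k-sets of parts.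

   The tester draws q triples (S, x, y), S a rho-biased set of parts and x, y
   uniform. For a k-set K of parts it counts the triples with S disjoint from K
   and f x != f (mix S x y). The probability of this event is at most
   a0 = (1 - rho)^k rho eps / 8 for some K if f is close, and at least 2 a0 for
   all K if f is far; a Chernoff bound and a union bound separate the cases. *)

Set Implicit Arguments.
Unset Strict Implicit.
Unset Printing Implicit Defensive.

Import Order.TTheory GRing.Theory Num.Theory.
Local Open Scope ring_scope.

(** * Nonadaptive randomized algorithms as trees of tosses and queries *)

(** Nested binary tosses realise a finite mixture. The weights stay unnormalized so that the
    induction can peel off [t], tossing with its share of the total [w t + W]. *)
Lemma mixture_ralg_seq (R : realType) (n : nat) (T : Type) (s : seq T)
    (w : T -> R) (A : T -> ralg R n) (N : nat) :
    (forall t, 0 <= w t) ->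
    (forall f t, (num_queries f (A t) <= N)%N) ->
  exists2 B : ralg R n,
    forall f b, (\sum_(t <- s) w t) * prob_output f b B =
                \sum_(t <- s) w t * prob_output f b (A t)
  & forall f, (num_queries f B <= N)%N.
Proof.
move=> w0 AN; elim: s => [|t s [B BE BN]].
  by exists (Output R n true) => // f b; rewrite !big_nil mul0r.
set W := \sum_(t <- s) w t in BE.
have W0 : 0 <= W by apply: sumr_ge0.
have pP : 0 <= w t / (w t + W) <= 1.
  (* A zero total is harmless: division by zero yields the legal probability 0, and both sides of
     the mixture identity vanish. *)
  have [->|wW] := eqVneq (w t + W) 0; first by rewrite invr0 mulr0 lexx ler01.
  have wWp : 0 < w t + W by rewrite lt_def wW addr_ge0.
  by rewrite divr_ge0 ?addr_ge0 //= ler_pdivrMr// mul1r lerDl.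
exists (Toss pP (A t) B) => [f b|f]; last by rewrite /= geq_max AN BN.
rewrite !big_cons /= -BE -/W.
have [wW|wW] := eqVneq (w t + W) 0.
  have /eqP := wW; rewrite paddr_eq0// => /andP[/eqP-> /eqP->].
  by rewrite addr0 !mul0r addr0.
by field.
Qed.

Fixpoint query_all (R : realType) (n : nat) (s : seq (cube n))
    (D : seq bool -> bool) : ralg R n :=
  if s is x :: s' then Query x (fun b => query_all R s' (fun bs => D (b :: bs)))
  else Output R n (D [::]).

Lemma prob_output_query_all (R : realType) n (s : seq (cube n)) D f b :
  prob_output f b (query_all R s D) = (D (map f s) == b)%:R.
Proof. by elim: s D => //= x s IHs D; rewrite IHs. Qed.

Lemma num_queries_query_all (R : realType) n (s : seq (cube n)) D f :
  num_queries f (query_all R s D) = size s.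
Proof. by elim: s D => //= x s IHs D; rewrite IHs. Qed.

(** Reduces the design of a tester to a random seed [t], a list of query points and a verdict
    determined by the values of [f] there. *)
Lemma nonadaptive_ralg (R : realType) (n N : nat) (T : finType) (w : T -> R)
    (s : T -> seq (cube n)) (D : T -> boolfun n -> bool) :
    (forall t, 0 <= w t) -> \sum_t w t = 1 ->
    (forall t, (size (s t) <= N)%N) ->
    (forall t (f g : boolfun n), {in s t, f =1 g} -> D t f = D t g) ->
  exists2 A : ralg R n,
    forall f b, prob_output f b A = \sum_(t | D t f == b) w t
  & (query_complexity A <= N)%N.
Proof.
move=> w0 w1 sN Ds.
(* The answers are extended to a full function by [false] off [s t]; by [Ds] the verdict does not
   see the extension. *)
pose alg t := query_all R (s t)
  (fun bs => D t [ffun x => nth false bs (index x (s t))]).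
have algN f t : (num_queries f (alg t) <= N)%N by rewrite num_queries_query_all.
have [A AE AN] := mixture_ralg_seq (index_enum T) w0 algN.
exists A => [f b|]; last by apply/bigmax_leqP => f _; exact: AN.
rewrite -[LHS]mul1r -w1 AE [RHS]big_mkcond; apply: eq_bigr => t _.
rewrite prob_output_query_all (Ds t _ f) => [|x xs]; first by case: (D t f == b); rewrite ?mulr1 ?mulr0.
by rewrite ffunE (nth_map x) ?index_mem// nth_index.
Qed.

(** * Influence of sets of variables and its Fourier expansion *)

Definition mix n (S : {set 'I_n}) (x y : cube n) : cube n :=
  [ffun i => if i \in S then y i else x i].

Definition influence (R : realType) n (f : boolfun n) (S : {set 'I_n}) : R :=
  (\sum_x \sum_(y : cube n) (f x != f (mix S x y))%:R) / (#|{: cube n}|%:R ^+ 2).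

Definition sgb (R : realType) (b : bool) : R := (-1) ^+ b.

Lemma card_cube_gt0 (R : realType) n : 0 < #|{: cube n}|%:R :> R.
Proof. by rewrite ltr0n; apply/card_gt0P; exists [ffun=> true]. Qed.

(** The number of [y] with [mix S x y = z] factors over coordinates: one choice of [y i] for [i] in
    [S], otherwise 2 or 0 according to whether [x i = z i], that is, 1 plus the product of the two
    signs. *)
Lemma sum_mixr (R : realType) n (S : {set 'I_n}) (x : cube n) (F : cube n -> R) :
  \sum_y F (mix S x y) =
  \sum_z F z * \prod_i (1 + (i \notin S)%:R * (sgb R (x i) * sgb R (z i))).
Proof.
rewrite (partition_big (mix S x) xpredT)//; apply: eq_bigr => z _.
under eq_bigr => y /eqP -> do rewrite -[F z]mulr1.
rewrite -mulr_sumr; congr (_ * _); rewrite big_mkcond /=.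
transitivity (\sum_(y : cube n)
    \prod_i ((if i \in S then y i else x i) == z i)%:R : R).
  apply: eq_bigr => y _; case: eqP => [<-|yz].
    by rewrite big1 // => i _; rewrite ffunE eqxx.
  have [i ne] : exists i, mix S x y i != z i.
    apply/existsP; apply: contra_notT yz => /existsPn h.
    by apply/ffunP => i; apply/eqP; rewrite -[_ == _]negbK h.
  by rewrite (bigD1 i) //=; move: ne; rewrite ffunE => /negPf->; rewrite mul0r.
rewrite -(bigA_distr_bigA (fun i b => ((if i \in S then b else x i) == z i)%:R : R)).
apply: eq_bigr => i _; rewrite big_bool /sgb.
by case: (i \in S); case: (x i); case: (z i); rewrite /= ?expr0 ?expr1; lra.
Qed.

(** Exchanging the [S]-coordinates of [x] and [y] is an involution on pairs, so [mix S x y] is as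
    uniform as [x]. *)
Lemma sum_mix (R : realType) n (S : {set 'I_n}) (F : cube n -> R) :
  \sum_x \sum_y F (mix S x y) = #|{: cube n}|%:R * \sum_x F x.
Proof.
pose h (p : cube n * cube n) := (mix S p.1 p.2, mix S p.2 p.1).
have hK : involutive h.
  by move=> [x y]; congr pair; apply/ffunP => i; rewrite !ffunE; case: (i \in S).
rewrite pair_bigA /= (reindex_inj (inv_inj hK)) /=.
rewrite (eq_bigr (fun p => F p.1)) => [|p _]; last first.
  by congr F; apply/ffunP => i; rewrite !ffunE; case: (i \in S).
rewrite -(pair_bigA _ (fun x _ => F x)) /= mulr_sumr.
by apply: eq_bigr => x _; rewrite sumr_const mulr_natl.
Qed.

(* With c U the (unnormalized) Fourier coefficient of f, summing
   c U ^+ 2 over the U disjoint from S yields, by expanding the product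
   \prod_i (1 + [i \notin S] x_i z_i), the correlation of f x and f (mix S x y). *)
Lemma influence_spectral (R : realType) n (f : boolfun n) :
  exists2 w : {set 'I_n} -> R, forall U, 0 <= w U &
    forall S, influence R f S = \sum_(U : {set 'I_n} | ~~ [disjoint U & S]) w U.
Proof.
set N : R := #|{: cube n}|%:R.
have N0 : N != 0 by rewrite gt_eqF// card_cube_gt0.
pose c (U : {set 'I_n}) := \sum_x sgb R (f x) * \prod_(i in U) sgb R (x i).
pose w U := c U ^+ 2 / (2 * N ^+ 2).
have corr S : \sum_x \sum_y sgb R (f x) * sgb R (f (mix S x y)) =
    \sum_(U : {set 'I_n} | [disjoint U & S]) c U ^+ 2.
  under eq_bigr => x _ do
    rewrite -mulr_sumr (sum_mixr _ _ (fun z => sgb R (f z))) mulr_sumr.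
  transitivity (\sum_x \sum_z \sum_(U : {set 'I_n} | [disjoint U & S])
      (sgb R (f x) * \prod_(i in U) sgb R (x i)) *
      (sgb R (f z) * \prod_(i in U) sgb R (z i))).
    apply: eq_bigr => x _; apply: eq_bigr => z _.
    rewrite mulrA (eq_bigr (fun i => (i \notin S)%:R * (sgb R (x i) * sgb R (z i)) + 1)); last first.
      by move=> i _; rewrite addrC.
    rewrite bigA_distr mulr_sumr [RHS]big_mkcond; apply: eq_bigr => U _.
    case: ifPn => [US|/pred0Pn[i /andP[/= iU iS]]]; last first.
      by rewrite (bigD1 i) //= iU iS /= !mul0r !mulr0.
    rewrite mulrACA; congr (_ * _); rewrite -big_split /= -big_mkcond /=.
    by apply: eq_bigr => i iU; rewrite (disjointFr US iU) mul1r.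
  under eq_bigr => x _ do rewrite exchange_big.
  rewrite exchange_big; apply: eq_bigr => U _.
  rewrite expr2 mulr_suml; apply: eq_bigr => x _; by rewrite mulr_sumr.
exists w => [U|S].
  by rewrite divr_ge0 ?sqr_ge0// mulr_ge0 ?sqr_ge0.
(* Parseval is the case of empty [S] in [corr]: nothing is resampled, so every product of signs is
   1. *)
have parseval : \sum_U c U ^+ 2 = N ^+ 2.
  rewrite (eq_bigl (fun U : {set 'I_n} => [disjoint U & finset.set0])); last first.
    by move=> U; apply/esym/pred0P => i /=; rewrite finset.in_set0 andbF.
  rewrite -corr (eq_bigr (fun=> N)) => [|x _].
    by rewrite sumr_const -mulr_natl.
  rewrite (eq_bigr (fun=> 1)) => [|y _]; first by rewrite sumr_const.
  have -> : mix finset.set0 x y = x by apply/ffunP => i; rewrite ffunE finset.in_set0.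
  by rewrite /sgb; case: (f x); rewrite ?expr0 ?expr1; lra.
have -> : influence R f S =
    (\sum_x \sum_y (1 - sgb R (f x) * sgb R (f (mix S x y))) / 2) / N ^+ 2.
  rewrite /influence; congr (_ / _); apply: eq_bigr => x _; apply: eq_bigr => y _.
  by rewrite /sgb; case: (f x); case: (f _); rewrite /= ?expr0 ?expr1; lra.
under eq_bigr => x _ do rewrite -mulr_suml sumrB.
rewrite -mulr_suml sumrB corr /w -mulr_suml.
rewrite (_ : \sum_x \sum_y 1 = N ^+ 2); last first.
  by under eq_bigr do rewrite sumr_const; rewrite sumr_const -mulrnA mulnn natrX.
rewrite -[X in X - _]parseval (bigID (fun U : {set 'I_n} => [disjoint U & S])) /=.
by rewrite addrAC subrr add0r; field.
Qed.

(** Resampling off [T] preserves [g], so a change of [f] forces [f] and [g] to differ at [x] or at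
    [mix S x y]. Both points are uniform, whence the factor 2. *)
Lemma close_influence (R : realType) n (f g : boolfun n) (T S : {set 'I_n}) :
  (forall x y : cube n, (forall i, i \in T -> x i = y i) -> g x = g y) ->
  [disjoint T & S] -> influence R f S <= 2 * dist R f g.
Proof.
move=> gT TS; set N : R := #|{: cube n}|%:R.
have N0 : 0 < N by exact: card_cube_gt0.
have -> : 2 * dist R f g =
   (\sum_x \sum_(y : cube n) (f x != g x)%:R +
    \sum_x \sum_y (f (mix S x y) != g (mix S x y))%:R) / N ^+ 2.
  have E : #|[set x : cube n | f x != g x]|%:R = \sum_x (f x != g x)%:R :> R.
    by rewrite -sum1_card natr_sum big_mkcond /=; apply: eq_bigr => x _; rewrite inE; case: eqP.
  rewrite (sum_mix S (fun x => (f x != g x)%:R)).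
  under eq_bigr => x _ do rewrite sumr_const -[_ *+ #|_|]mulr_natl.
  rewrite -mulr_sumr -E /dist -/N; have := lt0r_neq0 N0 => ?; by field.
rewrite ler_pM2r ?invr_gt0 ?exprn_gt0// -big_split ler_sum // => x _.
rewrite -big_split ler_sum // => y _ /=.
have <- : g x = g (mix S x y).
  by apply: gT => i iT; rewrite ffunE (disjointFr TS iT).
by case: (f x); case: (g x); case: (f _); rewrite /=; lra.
Qed.

(** Freezing the coordinates outside [J] to those of [y] turns [f] into a function of [J] alone. Its
    distance to [f], averaged over [y], is the influence, so some [y] does at least as well. *)
Lemma influence_close (R : realType) n (f : boolfun n) (J : {set 'I_n}) :
  exists2 g : boolfun n,
    forall x y : cube n, (forall i, i \in J -> x i = y i) -> g x = g y
  & dist R f g <= influence R f (~: J).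
Proof.
set N : R := #|{: cube n}|%:R.
have N0 : 0 < N by exact: card_cube_gt0.
pose g y : boolfun n := [ffun x => f (mix (~: J) x y)].
have gJ y (x x' : cube n) : (forall i, i \in J -> x i = x' i) -> g y x = g y x'.
  move=> xx'; rewrite !ffunE; congr (f _); apply/ffunP => i; rewrite !ffunE finset.in_setC.
  by case: (boolP (i \in J)) => //= /xx'.
have : exists y, dist R f (g y) <= influence R f (~: J).
  apply: contrapT => /forallNP far.
  suff : \sum_(y : cube n) influence R f (~: J) < \sum_(y : cube n) dist R f (g y).
    rewrite sumr_const /influence exchange_big /= -mulr_suml -[_ *+ #|_|]mulr_natl -/N.
    rewrite (_ : N * _ = (\sum_j \sum_i (f i != f (mix (~: J) i j))%:R) / N); last first.
      by have := lt0r_neq0 N0 => ?; field.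
    rewrite ltr_pM2r ?invr_gt0// lt_neqAle => /andP[/negP + _]; apply.
    apply/eqP; apply: eq_bigr => y _.
    rewrite -sum1_card natr_sum [RHS]big_mkcond /=; apply: eq_bigr => x _.
    by rewrite inE ffunE; case: eqP.
  apply: ltr_sum => [|y _]; last by rewrite ltNge; apply/negP/far.
  by apply/hasP; exists [ffun=> true]; rewrite // mem_index_enum.
by case=> y yP; exists (g y) => //; exact: gJ.
Qed.

(** * Random partitions of the variables *)

(** For the spectral weights of [f] this is the influence of [~: T]; the partition argument works
    for any nonnegative weights. *)
Definition outside (R : realType) (V : finType) (w : {set V} -> R) (T : {set V}) : R :=
  \sum_(U : {set V} | ~~ (U \subset T)) w U.

(** A map [p] from variables to labels encodes the partition into its fibres. *)
Definition pull (V L : finType) (p : {ffun V -> L}) (K : {set L}) : {set V} :=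
  [set i | p i \in K].

Section Outside.
Variables (R : realType) (V : finType) (w : {set V} -> R).
Hypothesis w0 : forall U, 0 <= w U.

Lemma outsideI (A B : {set V}) :
  outside w (A :&: B) <= outside w A + outside w B.
Proof.
rewrite /outside big_mkcond [X in _ <= X + _]big_mkcond [X in _ <= _ + X]big_mkcond.
rewrite -big_split ler_sum //= => U _; rewrite finset.subsetI.
by case: (U \subset A); case: (U \subset B); rewrite /= ?addr0 ?add0r // lerDl.
Qed.

(* Given T, let x range over the elements of B with T inside J x. Some U not
   inside T is inside at least half of these sets J x, since w gives
   more mass to the U inside J x and not inside T than to those not inside J x;
   adding such a U to T and iterating makes T large. *)
Lemma outside_greedy (X : finType) (J : X -> {set V}) (B : {set X}) (d : R) (m : nat) :
    0 < d ->
    (forall x, x \in B -> outside w (J x) < d) ->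
    (forall T : {set V}, (#|T| < m)%N -> 2 * d <= outside w T) ->
  exists2 T : {set V}, (m <= #|T|)%N &
    (#|B| <= 2 ^ m * #|[set x in B | T \subset J x]|)%N.
Proof.
move=> d0 Bd Td; elim: m Td => [|m IHm] Td.
  exists finset.set0 => //; rewrite expn0 mul1n subset_leq_card //.
  by apply/fintype.subsetP => x xB; rewrite inE xB finset.sub0set.
have [|T mT BT] := IHm; first by move=> T /ltnW; exact: Td.
have [mT'|Tm] := ltnP m #|T|.
  by exists T => //; rewrite (leq_trans BT)// leq_mul2r leq_exp2l// leqnSn orbT.
set C := [set x in B | T \subset J x] in BT.
have [U UT CU] : exists2 U : {set V}, ~~ (U \subset T) &
    (#|C| <= 2 * #|[set x in C | U \subset J x]|)%N.
  apply: contrapT => noU.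
  have {}noU (U : {set V}) : ~~ (U \subset T) ->
      (2 * #|[set x in C | U \subset J x]| < #|C|)%N.
    by move=> UT; rewrite ltnNge; apply/negP => h; apply: noU; exists U.
  have dT := Td T Tm.
  have C0 : (0 < #|C|)%N.
    have [U UT|noT] := pickP (fun U : {set V} => ~~ (U \subset T)).
      exact: leq_ltn_trans (noU U UT).
    by move: dT; rewrite /outside big_pred0 //; lra.
  have lo : #|C|%:R * (outside w T - d) <
      \sum_(x in C) \sum_(U : {set V} | ~~ (U \subset T) && (U \subset J x)) w U.
    rewrite mulr_natl -sumr_const; apply: ltr_sum => [|x].
      by have /card_gt0P[x xC] := C0; apply/hasP; exists x => //; rewrite mem_index_enum.
    rewrite inE => /andP[xB _]; rewrite ltrBlDr.
    apply: le_lt_trans (_ : _ <= \sum_(U : {set V} | ~~ (U \subset T) && (U \subset J x)) w U + outside w (J x)) _.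
      rewrite {1}/outside (bigID (fun U : {set V} => U \subset J x)) /= lerD2l.
      rewrite /outside big_mkcond [leRHS]big_mkcond ler_sum // => U _.
      by case: (U \subset T); case: (U \subset J x); rewrite //= w0.
    by rewrite ltrD2l Bd.
  have hi : 2 * (\sum_(x in C) \sum_(U : {set V} | ~~ (U \subset T) && (U \subset J x)) w U)
      <= #|C|%:R * outside w T.
    rewrite (exchange_big_dep (fun U : {set V} => ~~ (U \subset T))) /=; last by move=> x U _ /andP[].
    rewrite !mulr_sumr ler_sum // => U UT.
    rewrite (eq_bigl (fun x => x \in [set x in C | U \subset J x])); last first.
      by move=> x; rewrite !inE UT.
    rewrite sumr_const -[_ *+ #|_|]mulr_natl mulrA ler_wpM2r //.
    by rewrite -natrM ler_nat ltnW // noU.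
  (* As [C] is nonempty, chaining [lo] and [hi] gives [outside w T < 2 * d], against [dT]. *)
  have : (0 : R) < #|C|%:R by rewrite ltr0n.
  nra.
exists (T :|: U).
  apply: leq_ltn_trans mT (proper_card _).
  by rewrite properE finset.subsetUl finset.subUset fintype.subxx /=.
rewrite (leq_trans BT)// expnS -mulnA mulnCA leq_mul2l (leq_trans CU) ?orbT//.
rewrite leq_mul2l /= subset_leq_card //.
by apply/fintype.subsetP => x; rewrite !inE finset.subUset => /andP[/andP[-> ->] ->].
Qed.

End Outside.

Lemma card_subset_pull (R : realType) (V L : finType) (T : {set V}) (K : {set L}) :
  (0 < #|L|)%N ->
  #|[set p : {ffun V -> L} | T \subset pull p K]|%:R =
  (#|K|%:R / #|L|%:R) ^+ #|T| * #|{ffun V -> L}|%:R :> R.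
Proof.
move=> L0; have LR : #|L|%:R != 0 :> R by rewrite pnatr_eq0 -lt0n.
transitivity (\sum_(p : {ffun V -> L}) \prod_i ((i \in T) ==> (p i \in K))%:R : R).
  rewrite -sum1_card natr_sum big_mkcond; apply: eq_bigr => p _; rewrite inE.
  case: ifPn => [/fintype.subsetP TK|/subsetPn[i iT iK]].
    by rewrite big1 // => i _; case: (boolP (i \in T)) => //= /TK; rewrite inE => ->.
  by move: iK; rewrite inE (bigD1 i)//= iT => /negPf->; rewrite mul0r.
rewrite -(bigA_distr_bigA (fun i j => ((i \in T) ==> (j \in K))%:R : R)).
rewrite card_ffun natrX -[_ ^+ #|V|]prodr_const -[_ ^+ #|T|]prodr_const.
rewrite [X in _ = X * _]big_mkcond -big_split; apply: eq_bigr => i _ /=.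
case: (i \in T) => /=; last by rewrite mul1r sumr_const.
rewrite divfK // -sum1_card natr_sum [RHS]big_mkcond; apply: eq_bigr => j _.
by case: (j \in K).
Qed.

(** Union bound over ordered pairs of distinct elements of [S]: a fixed pair collides with
    probability [1 / #|L|]. *)
Lemma card_collision (R : realType) (V L : finType) (S : {set V}) :
  (0 < #|L|)%N ->
  #|[set p : {ffun V -> L} | ~~ [forall i in S, forall j in S, (p i == p j) ==> (i == j)]]|%:R
    <= #|S|%:R ^+ 2 / #|L|%:R * #|{ffun V -> L}|%:R :> R.
Proof.
move=> L0; have LR : #|L|%:R != 0 :> R by rewrite pnatr_eq0 -lt0n.
have pair i j : i != j ->
    #|[set p : {ffun V -> L} | p i == p j]|%:R = #|L|%:R^-1 * #|{ffun V -> L}|%:R :> R.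
  move=> ij; transitivity (\sum_(a : L)
      #|[set p : {ffun V -> L} | [set i; j] \subset pull p [set a]]|%:R : R).
    rewrite -sum1_card (partition_big (fun p : {ffun V -> L} => p i) xpredT) //= natr_sum.
    apply: eq_bigr => a _; rewrite -sum1_card; congr _%:R; apply: eq_bigl => p.
    rewrite !inE finset.subUset !finset.sub1set !inE.
    by apply/andP/andP => [[/eqP pij /eqP<-]|[/eqP-> /eqP->]]; rewrite ?pij.
  under eq_bigr do rewrite card_subset_pull// cards1 cards2 ij.
  by rewrite sumr_const -[_ *+ #|_|]mulr_natl; field.
apply: le_trans (_ : _ <= \sum_(ij in finset.setX S S | ij.1 != ij.2)
    #|[set p : {ffun V -> L} | p ij.1 == p ij.2]|%:R) _.
  rewrite -natr_sum ler_nat.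
  apply: leq_trans (_ : _ <= #|\bigcup_(ij in finset.setX S S | ij.1 != ij.2)
     [set p : {ffun V -> L} | p ij.1 == p ij.2]|)%N _; last first.
    elim/big_rec2 : _ => [|ij N A _ AN]; first by rewrite finset.cards0.
    by rewrite (leq_trans (leq_card_setU _ _)) // leq_add2l.
  apply/subset_leq_card/fintype.subsetP => p; rewrite inE.
  rewrite negb_forall_in => /exists_inP[i iS].
  rewrite negb_forall_in => /exists_inP[j jS]; rewrite negb_imply => /andP[pij ij].
  by apply/finset.bigcupP; exists (i, j); rewrite ?finset.in_setX /= ?iS ?jS // inE.
rewrite (eq_bigr (fun=> #|L|%:R^-1 * #|{ffun V -> L}|%:R)); last first.
  by move=> ij /andP[_ /pair].
rewrite sumr_const -[_ *+ #|_|]mulr_natl -mulrA ler_wpM2r//.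
rewrite -natrX ler_nat -mulnn -cardsX subset_leq_card //.
by apply/fintype.subsetP => ij /andP[].
Qed.

Lemma leq_ffact_exp n m : (n ^_ m <= n ^ m)%N.
Proof.
elim: m n => [|m IHm] n; first by rewrite ffactn0 expn0.
rewrite ffactnS expnS leq_mul2l (leq_trans (IHm _)) ?orbT//.
by case: m {IHm} => // m; rewrite leq_exp2r// leq_pred.
Qed.

Lemma leq_bin_exp n m : ('C(n, m) <= n ^ m)%N.
Proof.
by rewrite (leq_trans _ (leq_ffact_exp n m))// -bin_ffact leq_pmulr ?fact_gt0.
Qed.

Lemma far_partition (R : realType) (V : finType) (w : {set V} -> R) (k l : nat) (eps : R) :
    (forall U, 0 <= w U) -> (0 < k)%N -> 0 < eps -> l = (100 * k ^ 2)%N ->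
    (forall T : {set V}, (#|T| <= k)%N -> eps < outside w T) ->
  #|[set p : {ffun V -> 'I_l} | [exists K : {set 'I_l},
       (#|K| == k) && (outside w (pull p K) < eps / 4)]]|%:R
    <= 6^-1 * #|{ffun V -> 'I_l}|%:R :> R.
Proof.
move=> w0 k0 eps0 lE far.
have l0 : (0 < l)%N by rewrite lE muln_gt0 expn_gt0 k0.
have kR : 0 < k%:R :> R by rewrite ltr0n.
have lR : l%:R = 100 * k%:R ^+ 2 :> R by rewrite lE natrM natrX.
have P0 : 0 <= #|{ffun V -> 'I_l}|%:R :> R by [].
have [[S Sk Seps]|noS] := pselect (exists2 S : {set V}, (#|S| < 2 * k)%N & outside w S < eps / 2).
  (* A collision inside [S] has probability at most [(2 * k) ^ 2 / (100 * k ^ 2) = 1 / 25], below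
     1/6. *)
  apply: le_trans (_ : _ <= #|S|%:R ^+ 2 / #|'I_l|%:R * #|{ffun V -> 'I_l}|%:R) _; last first.
    rewrite ler_wpM2r// card_ord lR ler_pdivrMr ?mulr_gt0 ?exprn_gt0//.
    have : #|S|%:R <= 2 * k%:R :> R by rewrite -natrM ler_nat ltnW.
    have : 0 <= #|S|%:R :> R by [].
    nra.
  apply: le_trans (@card_collision R V _ S _); last by rewrite card_ord.
  rewrite ler_nat subset_leq_card //; apply/fintype.subsetP => p; rewrite !inE.
  move=> /existsP[K /andP[/eqP Kk Keps]].
  apply/negP => /forall_inP inj.
  have : eps < outside w (S :&: pull p K).
    apply: far; rewrite -Kk -(card_in_imset (f := p)); last first.
      move=> i j; rewrite !inE => /andP[iS _] /andP[jS _] pij.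
      by have /forall_inP/(_ j jS) := inj i iS; rewrite pij eqxx => /eqP.
    by rewrite subset_leq_card //; apply/fintype.subsetP => _ /imsetP[i + ->]; rewrite !inE => /andP[].
  by have := outsideI w0 S (pull p K); lra.
have big (T : {set V}) : (#|T| < 2 * k)%N -> 2 * (eps / 4) <= outside w T.
  by move=> Tk; rewrite leNgt; apply/negP => h; apply: noS; exists T => //; lra.
pose bads (K : {set 'I_l}) := [set p : {ffun V -> 'I_l} | outside w (pull p K) < eps / 4].
have bad (K : {set 'I_l}) : #|K| = k ->
    #|bads K|%:R <= (4 * (k%:R / l%:R) ^+ 2) ^+ k * #|{ffun V -> 'I_l}|%:R :> R.
  move=> Kk.
  have [|x|T Tk BT] := @outside_greedy R V w w0 _ (fun p => pull p K) (bads K) (eps / 4) _ _ _ big.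
  - by lra.
  - by rewrite inE.
  apply: le_trans (_ : _ <= (2 ^ (2 * k) * #|[set p | T \subset pull p K]|)%:R) _.
    rewrite ler_nat (leq_trans BT) // leq_mul2l subset_leq_card ?orbT //.
    by apply/fintype.subsetP => p; rewrite !inE => /andP[].
  (* Since [#|T| >= 2 * k] and [k <= l], the set [T] falls into [K] with probability at most
     [(k / l) ^ (2 * k)]; the greedy loss [2 ^ (2 * k)] is merged into the base. *)
  rewrite natrM card_subset_pull ?card_ord// Kk mulrA ler_wpM2r//.
  have -> : 4 * (k%:R / l%:R) ^+ 2 = (2 * (k%:R / l%:R)) ^+ 2 :> R by ring.
  rewrite -exprM natrX [leRHS]exprMn ler_wpM2l ?exprn_ge0// ler_wiXn2l ?divr_ge0//.
  by rewrite ler_pdivrMr ?ltr0n// mul1r ler_nat lE; nia.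
apply: le_trans (_ : _ <= \sum_(K : {set 'I_l} | #|K| == k) #|bads K|%:R) _.
  rewrite -natr_sum ler_nat.
  apply: leq_trans (_ : _ <= #|\bigcup_(K : {set 'I_l} | #|K| == k) bads K|)%N _; last first.
    elim/big_rec2 : _ => [|K N A _ AN]; first by rewrite finset.cards0.
    by rewrite (leq_trans (leq_card_setU _ _)) // leq_add2l.
  apply/subset_leq_card/fintype.subsetP => p; rewrite inE => /existsP[K /andP[Kk Keps]].
  by apply/finset.bigcupP; exists K => //; rewrite inE.
apply: le_trans (ler_sum _ (fun K Kk => bad K (eqP Kk))) _.
rewrite -mulr_suml ler_wpM2r // sumr_const.
rewrite (eq_card (B := [set K : {set 'I_l} | #|K| == k])); last by move=> K; rewrite inE.
rewrite card_draws card_ord -[_ *+ _]mulr_natl.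
(* Bounding the number of [k]-sets by [l ^ k] leaves the [k]-th power of
   [4 * k ^ 2 / l = 1 / 25]. *)
apply: le_trans (_ : _ <= l%:R ^+ k * (4 * (k%:R / l%:R) ^+ 2) ^+ k) _.
  by rewrite ler_wpM2r ?exprn_ge0 ?mulr_ge0 ?exprn_ge0 ?divr_ge0// -natrX ler_nat leq_bin_exp.
rewrite -[leLHS]exprMn.
have -> : l%:R * (4 * (k%:R / l%:R) ^+ 2) = 25^-1 :> R by rewrite lR; field; rewrite gt_eqF.
apply: le_trans (_ : _ <= 25^-1) _; last by lra.
by rewrite -[leRHS]expr1 ler_wiXn2l//; lra.
Qed.

(** * Biased random sets and Chernoff bounds *)

Definition biased (R : realType) (L : finType) (rho : R) (S : {set L}) : R :=
  \prod_j (if j \in S then rho else 1 - rho).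

(** A coordinate contributes [rho] on [A], [1 - rho] on [B] and [rho + (1 - rho) = 1] elsewhere;
    expanding the product of these sums yields the sum over [S]. *)
Lemma sum_biased (R : realType) (L : finType) (rho : R) (A B : {set L}) :
    [disjoint A & B] ->
  \sum_(S : {set L} | (A \subset S) && [disjoint S & B]) biased rho S =
  rho ^+ #|A| * (1 - rho) ^+ #|B|.
Proof.
move=> AB; rewrite -!prodr_const [X in X * _]big_mkcond [X in _ * X]big_mkcond.
rewrite -big_split /=.
transitivity (\prod_j ((j \notin B)%:R * rho + (j \notin A)%:R * (1 - rho))); last first.
  apply: eq_bigr => j _.
  by case: (boolP (j \in A)) => [/(disjointFr AB)->|_]; case: (j \in B) => /=; lra.
rewrite bigA_distr big_mkcond; apply: eq_bigr => S _.
case: ifPn => [/andP[/fintype.subsetP AS SB]|].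
  apply: eq_bigr => j _; case: (boolP (j \in S)) => jS.
    by rewrite (disjointFr SB jS) mul1r.
  by rewrite (contra (AS j) jS) mul1r.
rewrite negb_and => /orP[/subsetPn[j jA jS]|/pred0Pn[j /andP[/= jS jB]]].
  by rewrite (bigD1 j)//= (negPf jS) jA mul0r mul0r.
by rewrite (bigD1 j)//= jS jB mul0r mul0r.
Qed.

(** It suffices to force one element [j] of [A] outside [B] into [S]. *)
Lemma sum_biased_meet_ge (R : realType) (L : finType) (rho : R) (A B : {set L}) :
    0 <= rho <= 1 -> ~~ (A \subset B) ->
  rho * (1 - rho) ^+ #|B| <=
  \sum_(S : {set L} | ~~ [disjoint A & S] && [disjoint S & B]) biased rho S.
Proof.
move=> /andP[r0 r1] /subsetPn[j jA jB].
have -> : rho * (1 - rho) ^+ #|B| = rho ^+ #|[set j]| * (1 - rho) ^+ #|B|.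
  by rewrite cards1 expr1.
rewrite -sum_biased; last by rewrite disjoints1.
rewrite big_mkcond [leRHS]big_mkcond ler_sum // => S _.
have b0 : 0 <= biased rho S by apply: prodr_ge0 => i _; case: ifP => _; lra.
rewrite finset.sub1set; case: (boolP (j \in S)) => [jS|_] /=; last by case: ifP.
suff -> : ~~ [disjoint A & S] by [].
by apply/pred0Pn; exists j; rewrite /= jA.
Qed.

(** Markov's inequality for the exponential moment, bounded through [1 + u <= expR u]. Keeping [s]
    in the tail condition covers the upper tail ([s > 0]) and the lower tail ([s < 0]) at once. *)
Lemma chernoff (R : realType) (Z : finType) (v : Z -> R) (hit : pred Z) (q : nat) (s t : R) :
    (forall z, 0 <= v z) -> \sum_z v z = 1 ->
  \sum_(o : {ffun 'I_q -> Z} | s * t <= s * #|[set i | hit (o i)]|%:R) \prod_i v (o i)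
    <= expR (q%:R * ((\sum_(z | hit z) v z) * (expR s - 1)) - s * t).
Proof.
move=> v0 v1; set a := \sum_(z | hit z) v z.
have mgf : \sum_(o : {ffun 'I_q -> Z}) (\prod_i v (o i)) * expR (s * #|[set i | hit (o i)]|%:R)
    = (1 + a * (expR s - 1)) ^+ q.
  transitivity (\prod_(i < q) \sum_z v z * expR (s * (hit z)%:R)).
    rewrite bigA_distr_bigA; apply: eq_bigr => o _; rewrite big_split; congr (_ * _).
    rewrite -expR_sum -mulr_sumr; congr (expR (_ * _)).
    rewrite -sum1_card natr_sum big_mkcond; apply: eq_bigr => i _.
    by rewrite inE; case: (hit _).
  rewrite prodr_const card_ord; congr (_ ^+ _).
  rewrite -[X in X + _]v1 /a mulr_suml [X in _ + X]big_mkcond -big_split; apply: eq_bigr => z _ /=.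
  by case: (hit z); rewrite /= ?mulr1 ?mulr0 ?expR0; ring.
apply: le_trans (_ : _ <= (1 + a * (expR s - 1)) ^+ q * expR (- (s * t))) _; last first.
  rewrite expRD ler_wpM2r ?expR_ge0// expRM_natl.
  have a0 : 0 <= a by apply: sumr_ge0.
  have a1 : a <= 1 by rewrite -v1 /a big_mkcond ler_sum // => z _; case: ifP.
  by rewrite lerXn2r ?nnegrE ?expR_ge0 ?expR_ge1Dx//; have := expR_ge0 s; nra.
rewrite -mgf mulr_suml big_mkcond ler_sum // => o _.
have p0 : 0 <= \prod_i v (o i) by apply: prodr_ge0.
case: ifP => st; last by rewrite !mulr_ge0 ?expR_ge0.
rewrite -mulrA -expRD ler_peMr //.
by apply: le_trans (expR_ge1Dx _); rewrite lerDl subr_ge0.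
Qed.

Section Tails.
Variables (R : realType) (Z : finType) (v : Z -> R) (hit : pred Z) (q : nat) (a0 : R).
Hypotheses (v0 : forall z, 0 <= v z) (v1 : \sum_z v z = 1).

(** At [s = 1/4], the estimate [expR 4^-1 <= 4/3] gives the exponent [1/3 - 3/8 = - 1/24] per unit
    of [q * a0]. *)
Lemma upper_tail : 0 <= a0 -> \sum_(z | hit z) v z <= a0 ->
  \sum_(o : {ffun 'I_q -> Z} | 3 / 2 * (q%:R * a0) <= #|[set i | hit (o i)]|%:R) \prod_i v (o i)
    <= expR (- (q%:R * a0 / 24)).
Proof.
move=> a00 aa.
have e3 : expR 4^-1 - 1 <= 3^-1 :> R.
  have h := expR_ge1Dx (- 4^-1 : R); rewrite expRN in h.
  have : expR 4^-1 <= (3 / 4)^-1 :> R; last by lra.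
  by rewrite -[leLHS]invrK lef_pV2 ?posrE ?invr_gt0 ?expR_gt0//; lra.
have e0 : 0 <= expR 4^-1 - 1 :> R by have := expR_ge1Dx (4^-1 : R); lra.
have := chernoff hit q 4^-1 (3 / 2 * (q%:R * a0)) v0 v1.
rewrite (eq_bigl (fun o : {ffun 'I_q -> Z} => 3 / 2 * (q%:R * a0) <= #|[set i | hit (o i)]|%:R)).
  move=> /le_trans; apply; rewrite ler_expR.
  have := ler_pM (sumr_ge0 _ (fun z _ => v0 z)) e0 aa e3.
  by move=> /(ler_wpM2l (ler0n R q)); lra.
by move=> o; rewrite ler_pM2l ?invr_gt0.
Qed.

(** At [s = - 1/4], the estimate [expR (- 4^-1) <= 4/5] gives the exponent [- 2/5 + 3/8 = - 1/40]
    per unit of [q * a0]. *)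
Lemma lower_tail : 0 <= a0 -> 2 * a0 <= \sum_(z | hit z) v z ->
  \sum_(o : {ffun 'I_q -> Z} | #|[set i | hit (o i)]|%:R < 3 / 2 * (q%:R * a0)) \prod_i v (o i)
    <= expR (- (q%:R * a0 / 40)).
Proof.
move=> a00 aa.
have e3 : expR (- 4^-1) - 1 <= - 5^-1 :> R.
  have h := expR_ge1Dx (4^-1 : R).
  have : expR (- 4^-1) <= (5 / 4)^-1 :> R; last by lra.
  by rewrite expRN lef_pV2 ?posrE ?expR_gt0//; lra.
have := chernoff hit q (- 4^-1) (3 / 2 * (q%:R * a0)) v0 v1.
rewrite (eq_bigl (fun o : {ffun 'I_q -> Z} => #|[set i | hit (o i)]|%:R <= 3 / 2 * (q%:R * a0))).
  move=> chern; apply: le_trans (le_trans _ chern) _.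
    rewrite big_mkcond [leRHS]big_mkcond ler_sum // => o _.
    by case: ltP => h; [rewrite (ltW h) | case: ifP => // _; apply: prodr_ge0].
  rewrite ler_expR; set a := \sum_(z | _) v z in aa *.
  have : a * (expR (- 4^-1) - 1) <= 2 * a0 * - 5^-1 by nra.
  by move=> /(ler_wpM2l (ler0n R q)); lra.
by move=> o; rewrite ler_nM2l ?oppr_lt0 ?invr_gt0.
Qed.

End Tails.

Lemma ex_superset_card (L : finType) (A : {set L}) (k : nat) :
  (#|A| <= k <= #|L|)%N -> exists2 K : {set L}, A \subset K & #|K| = k.
Proof.
move=> /andP[Ak]; elim: k Ak => [|k IHk] Ak kL.
  by exists A => //; apply/eqP; rewrite -leqn0.
move: Ak; rewrite leq_eqVlt => /predU1P[<-|Ak]; first by exists A.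
have [K AK Kk] := IHk Ak (ltnW kL).
have [j jK] : exists j, j \notin K.
  apply/existsP; apply: contraLR kL => /existsPn K1; rewrite -leqNgt -Kk.
  by apply/subset_leq_card/fintype.subsetP => j _; rewrite -[_ \in _]negbK K1.
exists (j |: K); last by rewrite cardsU1 jK Kk.
by rewrite (fintype.subset_trans AK)// finset.subsetUr.
Qed.

(** * Random triples and their hit probabilities *)

Section Sampling.
Variables (R : realType) (n : nat) (L : finType) (rho : R).
Hypothesis rho01 : 0 < rho < 1.

Definition sample : finType := ({set L} * (cube n * cube n))%type.

Definition sample_weight (z : sample) : R :=
  biased rho z.1 / #|{: cube n}|%:R ^+ 2.

Definition hits (f : boolfun n) (p : {ffun 'I_n -> L}) (K : {set L}) (z : sample) :=
  [disjoint z.1 & K] && (f z.2.1 != f (mix (pull p z.1) z.2.1 z.2.2)).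

Lemma biased_ge0 (S : {set L}) : 0 <= biased rho S.
Proof.
have /andP[r0 r1] := rho01.
by apply: prodr_ge0 => i _; case: ifP => _; lra.
Qed.

Lemma sample_weight_ge0 z : 0 <= sample_weight z.
Proof. by rewrite divr_ge0 ?biased_ge0// exprn_ge0. Qed.

Lemma sum_sample (P : pred {set L}) (F : {set L} -> cube n -> cube n -> bool) :
  \sum_(z : sample | P z.1 && F z.1 z.2.1 z.2.2) sample_weight z =
  \sum_(S | P S) biased rho S *
     ((\sum_x \sum_y (F S x y)%:R) / #|{: cube n}|%:R ^+ 2).
Proof.
rewrite -(pair_big_dep P (fun S xy => F S xy.1 xy.2) (fun S xy => sample_weight (S, xy))) /=.
apply: eq_bigr => S _; rewrite pair_bigA mulr_suml mulr_sumr /= big_mkcond.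
by apply: eq_bigr => xy _; rewrite /sample_weight /=; case: F; rewrite ?mul1r ?mul0r ?mulr0.
Qed.

Lemma sum_sample_weight : \sum_z sample_weight z = 1.
Proof.
have := sum_sample xpredT (fun _ _ _ => true); rewrite /= => ->.
under eq_bigr => S _.
  under eq_bigr do rewrite sumr_const.
  rewrite sumr_const -mulrnA mulnn natrX divff ?mulr1; first over.
  by rewrite expf_neq0// gt_eqF// card_cube_gt0.
have := @sum_biased R L rho finset.set0 finset.set0.
rewrite finset.cards0 expr0 mulr1 => <-; last by rewrite -setI_eq0 finset.set0I.
by apply: eq_bigl => S; rewrite finset.sub0set disjoint_sym -setI_eq0 finset.set0I eqxx.
Qed.

Lemma sum_hits f p K :
  \sum_(z | hits f p K z) sample_weight z =
  \sum_(S : {set L} | [disjoint S & K]) biased rho S * influence R f (pull p S).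
Proof. exact: sum_sample. Qed.

(** A set of parts avoiding [K] resamples no variable of [T], so [close_influence] applies to it;
    [K] is avoided with probability [(1 - rho) ^+ #|K|]. *)
Lemma sum_hits_close f (g : boolfun n) p K (T : {set 'I_n}) :
    (forall x y : cube n, (forall i, i \in T -> x i = y i) -> g x = g y) ->
    T \subset pull p K ->
  \sum_(z | hits f p K z) sample_weight z <= (1 - rho) ^+ #|K| * (2 * dist R f g).
Proof.
move=> gT TK; rewrite sum_hits.
have := @sum_biased R L rho finset.set0 K.
rewrite finset.cards0 expr0 mul1r => <-; last by rewrite -setI_eq0 finset.set0I.
rewrite mulr_suml (eq_bigl (fun S : {set L} => (finset.set0 \subset S) && [disjoint S & K])).
  apply: ler_sum => S /andP[_ SK]; rewrite ler_wpM2l ?biased_ge0//.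
  apply: (@close_influence R n f g T _ gT); apply/pred0P => i /=; apply/andP => -[iT iS].
  have /fintype.subsetP/(_ i iT) := TK; move: iS; rewrite !inE => pS.
  by rewrite (disjointFr SK pS).
by move=> S; rewrite finset.sub0set.
Qed.

(** After exchanging the sums over [S] and [U]: a [U] not inside [pull p K] reaches a part outside
    [K], and [S] contains that part while avoiding [K] with probability
    [rho * (1 - rho) ^+ #|K|]. *)
Lemma sum_hits_far f (p : {ffun 'I_n -> L}) (K : {set L}) (w : {set 'I_n} -> R) :
    (forall U, 0 <= w U) ->
    (forall S, influence R f S = \sum_(U : {set 'I_n} | ~~ [disjoint U & S]) w U) ->
  rho * (1 - rho) ^+ #|K| * outside w (pull p K) <=
  \sum_(z | hits f p K z) sample_weight z.
Proof.
move=> w0 fw; rewrite sum_hits.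
under eq_bigr => S _ do rewrite fw mulr_sumr.
rewrite (exchange_big_dep xpredT) //= mulr_sumr big_mkcond ler_sum // => U _.
have s0 : 0 <= \sum_(S : {set L} | [disjoint S & K] && ~~ [disjoint U & pull p S]) biased rho S * w U.
  by apply: sumr_ge0 => S _; rewrite mulr_ge0 ?biased_ge0.
case: ifPn => // UK.
rewrite -mulr_suml ler_wpM2r //.
apply: le_trans (@sum_biased_meet_ge R L rho (p @: U) K _ _) _.
- by have /andP[r0 r1] := rho01; rewrite !ltW.
- apply: contra UK => /fintype.subsetP UK; apply/fintype.subsetP => i iU.
  by rewrite inE UK // imset_f.
(* [U] meets [pull p S] exactly when its image under [p] meets [S]. *)
rewrite le_eqVlt; apply/orP; left; apply/eqP; apply: eq_bigl => S; rewrite andbC.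
congr (_ && ~~ _); apply/pred0P/pred0P => h i /=; apply/andP => -[].
  move=> iU; rewrite inE => iS; have /= := h (p i); by rewrite imset_f// iS.
by move=> /imsetP[j jU ->] pS; have /= := h j; rewrite jU inE pS.
Qed.

End Sampling.

(** * Numerical estimates for the union bound *)

Section Constants.
Variables (R : realType) (k : nat).
Hypothesis k0 : (0 < k)%N.
Let entropy : R := k%:R * ln k.+1%:R.

Lemma expR_entropy : expR entropy = (k.+1 ^ k)%:R.
Proof. by rewrite expRM_natl lnK ?posrE ?ltr0n// natrX. Qed.

(** Allows the rounding of the sample count to be absorbed into the main term. *)
Lemma entropy_ge : 2^-1 <= entropy.
Proof.
rewrite -ler_expR expR_entropy.
apply: le_trans (_ : _ <= 2) _.
  have := expR_ge1Dx (- 2^-1 : R); rewrite expRN => h.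
  rewrite -[leLHS]invrK -[leRHS]invrK lef_pV2 ?posrE ?invr_gt0 ?expR_gt0//.
  by apply: le_trans h; lra.
by rewrite ler_nat (@leq_trans (2 ^ k)) ?leq_exp2r// -[X in (X <= _)%N]expn1 leq_exp2l.
Qed.

(** From [100 <= 2 ^ 7 <= k.+1 ^ 7] the first factor is at most [expR entropy ^+ 9], while [x / 40]
    is at least [12 * entropy]; the remaining [expR (- (3 * entropy))] is at most 1/8. *)
Lemma union_bound_small (x : R) : 480 * entropy <= x ->
  ((100 * k ^ 2) ^ k)%:R * expR (- (x / 40)) <= 6^-1.
Proof.
move=> xE; have e0 := expR_gt0 entropy.
have e2 : 2 <= expR entropy.
  rewrite expR_entropy ler_nat (@leq_trans (2 ^ k)) ?leq_exp2r//.
  by rewrite -[X in (X <= _)%N]expn1 leq_exp2l.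
apply: le_trans (_ : _ <= expR entropy ^+ 9 * expR (- (12 * entropy))) _.
  apply: ler_pM => //.
    rewrite expR_entropy -natrX ler_nat -expnM (mulnC k) expnM leq_exp2r //.
    rewrite (_ : 9%N = (7 + 2)%N)// expnD leq_mul ?leq_exp2r//.
    by rewrite (@leq_trans (2 ^ 7)) // leq_exp2r.
  by rewrite ler_expR; lra.
rewrite -expRM_natl -expRD (_ : _ + _ = - (3 * entropy)); last by ring.
rewrite expRN expRM_natl lef_pV2 ?posrE ?exprn_gt0//.
by apply: le_trans (_ : _ <= 2 ^+ 3) _; [lra | rewrite lerXn2r ?nnegrE// ltW].
Qed.

End Constants.

(** * The tester and its analysis *)

Definition is_junta_tester (R : realType) (n k : nat) (eps rho : R) (A : ralg R n) :=
  [/\ forall f : boolfun n,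
        (exists2 g : boolfun n, junta k g & eps_close (rho * eps / 16%:R) f g) ->
        2%:R / 3%:R <= prob_accept A f,
      forall f : boolfun n,
        (forall g : boolfun n, junta k g -> eps_far eps f g) ->
        2%:R / 3%:R <= prob_reject A f
    & (query_complexity A)%:R <=
        7684 * (k%:R * ln (k.+1)%:R / (eps * rho * (1 - rho) ^+ k))].

Lemma junta_tester (R : realType) (n k : nat) (eps rho : R) :
    (1 <= k)%N -> 0 < eps < 1 -> 0 < rho < 1 ->
  exists A : ralg R n, is_junta_tester k eps rho A.
Proof.
move=> k0 /andP[eps0 eps1] rho01; have /andP[rho0 rho1] := rho01.
have [E [EE E2 union_small]] : exists E : R, [/\ k%:R * ln (k.+1)%:R = E, 2^-1 <= E &
    forall x, 480 * E <= x -> ((100 * k ^ 2) ^ k)%:R * expR (- (x / 40)) <= 6^-1].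
  exists (k%:R * ln (k.+1)%:R); split=> // [|x]; first exact: entropy_ge.
  exact: union_bound_small.
rewrite /is_junta_tester EE.
have [l lE] : exists l, l = (100 * k ^ 2)%N by eexists.
rewrite -lE in union_small.
have l0 : (0 < l)%N by rewrite lE muln_gt0 expn_gt0 k0.
have kl : (k <= l)%N by rewrite lE expnS expn1 mulnA leq_pmull// muln_gt0.
have r0 : 0 < (1 - rho) ^+ k by rewrite exprn_gt0// subr_gt0.
(* This is the close-case bound [(1 - rho) ^+ k * (2 * (rho * eps / 16))], and half of the far-case
   bound [rho * (1 - rho) ^+ k * (eps / 4)]. *)
have [a0 a0E] : exists a0 : R, a0 = (1 - rho) ^+ k * rho * eps / 8 by eexists.
have a00 : 0 < a0 by rewrite a0E divr_gt0 ?mulr_gt0.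
have [q qlo qhi] : exists2 q : nat, 480 * E <= q%:R * a0 & q%:R <= 480 * E / a0 + 1.
  exists (Num.truncn (480 * E / a0)).+1.
    by rewrite -ler_pdivrMr// ltW// truncnS_gt.
  rewrite -[_.+1%:R]natr1 lerD2r truncn_le.
  by apply: divr_ge0; [lra | exact: ltW].
pose Z := sample n 'I_l; pose P := {ffun 'I_n -> 'I_l}.
pose v : Z -> R := @sample_weight R n 'I_l rho.
have v0 z : 0 <= v z by exact: sample_weight_ge0.
have v1 : \sum_z v z = 1 by exact: sum_sample_weight.
have Pn0 : 0 < #|P|%:R :> R.
  by rewrite ltr0n; apply/card_gt0P; exists [ffun=> Ordinal l0].
(* The seed is a uniform partition together with [q] independent samples. *)
pose W (t : P * {ffun 'I_q -> Z}) : R := #|P|%:R^-1 * \prod_i v (t.2 i).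
have W0 t : 0 <= W t by rewrite mulr_ge0 ?invr_ge0 // prodr_ge0.
have vv1 : \sum_(o : {ffun 'I_q -> Z}) \prod_i v (o i) = 1.
  by rewrite -(bigA_distr_bigA (fun _ z => v z)) prodr_const v1 expr1n.
have sumW (D : P -> pred {ffun 'I_q -> Z}) :
    \sum_(t | D t.1 t.2) W t = #|P|%:R^-1 * \sum_p \sum_(o | D p o) \prod_i v (o i).
  rewrite mulr_sumr -(pair_big_dep xpredT D (fun p o => W (p, o))) /=.
  by apply: eq_bigr => p _; rewrite mulr_sumr.
have W1 : \sum_t W t = 1.
  have := sumW (fun _ _ => true); rewrite /= => ->.
  by under eq_bigr do rewrite vv1; rewrite sumr_const mulVf ?gt_eqF.
pose N (f : boolfun n) (p : P) (K : {set 'I_l}) (o : {ffun 'I_q -> Z}) :=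
  #|[set i | hits f p K (o i)]|.
(* The threshold is halfway between the expected counts [q * a0] and [2 * (q * a0)] that separate
   the two cases. *)
pose tau : R := 3 / 2 * (q%:R * a0).
pose accepts f p o := [exists K : {set 'I_l}, (#|K| == k) && ((N f p K o)%:R < tau)].
pose s (t : P * {ffun 'I_q -> Z}) : seq (cube n) :=
  codom (fun i => (t.2 i).2.1) ++
  codom (fun i => mix (pull t.1 (t.2 i).1) (t.2 i).2.1 (t.2 i).2.2).
have [A AE AN] : exists2 A : ralg R n,
    forall f b, prob_output f b A = \sum_(t | accepts f t.1 t.2 == b) W t
    & (query_complexity A <= 2 * q)%N.
  apply: (@nonadaptive_ralg R n (2 * q) _ W s (fun t f => accepts f t.1 t.2)) => //.
    by move=> t; rewrite size_cat !size_codom card_ord mul2n addnn.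
  move=> t f g fg; apply: eq_existsb => K; congr (_ && (_%:R < _)).
  apply: eq_card => i; rewrite !inE /hits !fg //.
    by rewrite mem_cat orbC (codom_f (fun i => mix (pull t.1 (t.2 i).1) (t.2 i).2.1 (t.2 i).2.2)).
  by rewrite mem_cat (codom_f (fun i => (t.2 i).2.1)).
exists A; split.
- move=> f [g [T Tk gT] fg].
  rewrite /prob_accept AE (eq_bigl (fun t => accepts f t.1 t.2)); last first.
    by move=> t; case: (accepts f t.1 t.2).
  have := W1; rewrite (bigID (fun t => accepts f t.1 t.2)) /=.
  suff : \sum_(t | ~~ accepts f t.1 t.2) W t <= 3^-1 by lra.
  rewrite (sumW (fun p o => ~~ accepts f p o)) ler_pdivrMl// -[#|P|%:R]/(#|P|%:R) mulrC mulr_natr.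
  rewrite -sumr_const ler_sum // => p _.
  (* For every partition, the parts meeting [T], padded to exactly [k] parts, form a [K] that should
     trigger acceptance. *)
  have [|K TK Kk] := @ex_superset_card 'I_l (p @: T) k.
    by rewrite (leq_trans (leq_imset_card _ _) Tk) card_ord.
  have TpK : T \subset pull p K.
    apply/fintype.subsetP => i iT; rewrite inE.
    by have /fintype.subsetP := TK; apply; exact: imset_f.
  have aa : \sum_(z | hits f p K z) v z <= a0.
    apply: le_trans (@sum_hits_close R n 'I_l rho rho01 f g p K T gT TpK) _.
    rewrite Kk a0E -!mulrA ler_wpM2l ?(ltW r0)//.
    by move: fg; rewrite /eps_close; lra.
  apply: le_trans (_ : _ <= expR (- (q%:R * a0 / 24))) _.
    apply: le_trans (upper_tail q v0 v1 (ltW a00) aa).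
    rewrite big_mkcond [leRHS]big_mkcond ler_sum // => o _.
    have p0 : 0 <= \prod_i v (o i) by apply: prodr_ge0.
    case: ifPn => [/existsPn/(_ K)|_]; last by case: ifP.
    by rewrite Kk eqxx /= -leNgt => ->.
  have u := union_small _ qlo.
  apply: le_trans (_ : _ <= 6^-1) _; last by lra.
  apply: le_trans u; rewrite -[leLHS]mul1r ler_pM ?expR_ge0//.
    by rewrite ler1n expn_gt0 l0.
  by rewrite ler_expR; nra.
- move=> f far.
  have [w w0 fw] := influence_spectral R f.
  have fout T : influence R f (~: T) = outside w T.
    rewrite fw; apply: eq_bigl => U; by rewrite finset.disjoints_subset finset.setCK.
  have wfar (T : {set 'I_n}) : (#|T| <= k)%N -> eps < outside w T.
    move=> Tk; have [g gT fg] := influence_close R f T.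
    rewrite -fout; apply: lt_le_trans fg; apply: far.
    by exists T.
  have bad := @far_partition R 'I_n w k l eps w0 k0 eps0 lE wfar.
  set B := finset _ in bad.
  rewrite /prob_reject AE (eq_bigl (fun t => ~~ accepts f t.1 t.2)); last first.
    by move=> t; case: (accepts f t.1 t.2).
  have := W1; rewrite (bigID (fun t => accepts f t.1 t.2)) /=.
  suff : \sum_(t | accepts f t.1 t.2) W t <= 3^-1 by lra.
  rewrite (sumW (accepts f)) ler_pdivrMl//.
  (* Bad partitions, of density at most 1/6, are charged probability 1; any other partition accepts
     with probability at most 1/6. *)
  apply: le_trans (_ : _ <= \sum_(p : P) ((p \in B)%:R + 6^-1)) _; last first.
    rewrite big_split /= sumr_const -[_ *+ #|_|]mulr_natl.
    rewrite (_ : \sum_p _ = #|B|%:R); first by lra.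
    by rewrite -sum1_card natr_sum [RHS]big_mkcond; apply: eq_bigr => p _; case: (p \in B).
  apply: ler_sum => p _; case: (boolP (p \in B)) => [_|pB].
    apply: le_trans (_ : _ <= 1) _; last by rewrite lerDl invr_ge0.
    rewrite -[leRHS]vv1 [leLHS]big_mkcond ler_sum // => o _.
    by case: ifP => // _; apply: prodr_ge0.
  rewrite add0r.
  have out (K : {set 'I_l}) : #|K| = k -> eps / 4 <= outside w (pull p K).
    move=> Kk; rewrite leNgt; apply: contra pB => h; rewrite inE.
    by apply/existsP; exists K; rewrite Kk eqxx.
  have one (K : {set 'I_l}) : #|K| = k ->
      \sum_(o | (N f p K o)%:R < tau) \prod_i v (o i) <= expR (- (q%:R * a0 / 40)).
    move=> Kk; apply: (lower_tail q v0 v1 (ltW a00)).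
    apply: le_trans (@sum_hits_far R n 'I_l rho rho01 f p K w w0 fw).
    apply: le_trans (_ : _ <= rho * (1 - rho) ^+ #|K| * (eps / 4)) _.
      by rewrite Kk a0E; lra.
    by rewrite ler_wpM2l ?out// Kk mulr_ge0 ?(ltW r0) ?(ltW rho0).
  apply: le_trans (union_small _ qlo).
  apply: le_trans (_ : _ <= \sum_(K : {set 'I_l} | #|K| == k) expR (- (q%:R * a0 / 40))) _; last first.
    rewrite sumr_const -[_ *+ _]mulr_natl ler_wpM2r ?expR_ge0// ler_nat.
    rewrite (eq_card (B := [set K : {set 'I_l} | #|K| == k])); last by move=> K; rewrite inE.
    by rewrite card_draws card_ord leq_bin_exp.
  apply: le_trans (ler_sum _ (fun K Kk => one K (eqP Kk))).
  rewrite (exchange_big_dep xpredT) //= big_mkcond ler_sum // => o _.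
  have p0 : 0 <= \prod_i v (o i) by apply: prodr_ge0.
  case: ifP => [/existsP[K /andP[Kk KN]]|_]; last by apply: sumr_ge0.
  by rewrite (bigD1 K) ?Kk//= lerDl sumr_ge0.
- apply: le_trans (_ : _ <= (2 * q)%:R) _; first by rewrite ler_nat.
  rewrite natrM; apply: le_trans (_ : _ <= 2 * (480 * E / a0 + 1)) _; first by rewrite ler_wpM2l.
  set X := eps * rho * (1 - rho) ^+ k.
  have X0 : 0 < X by rewrite !mulr_gt0.
  have X1 : X <= 1.
    have r1 : (1 - rho) ^+ k <= 1 by apply: exprn_ile1; lra.
    apply: mulr_ile1 => //; [exact/ltW/mulr_gt0 | exact: ltW | ].
    by apply: mulr_ile1; exact: ltW.
  have -> : a0 = X / 8 by rewrite a0E /X; ring.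
  (* Rounding adds at most [2 * (E / X)], as [E >= 1/2] and [X <= 1]; hence the constant
     [7684 = 2 * (3840 + 2)]. *)
  have : 1 <= 2 * (E / X) by rewrite mulrA ler_pdivlMr//; lra.
  have -> : 480 * E / (X / 8) = 3840 * (E / X) by field; rewrite gt_eqF.
  by lra.
Qed.

Theorem theorem1p2 (R : realType) :
  exists2 C : R, 0 < C &
  exists tester : forall n : nat, nat -> R -> R -> ralg R n,
  forall (n k : nat) (eps rho : R),
    (1 <= k)%N -> 0 < eps < 1 -> 0 < rho < 1 ->
    [/\ forall f : boolfun n,
          (exists2 g : boolfun n, junta k g & eps_close (rho * eps / 16%:R) f g) ->
          2%:R / 3%:R <= prob_accept (tester n k eps rho) f,
        forall f : boolfun n,
          (forall g : boolfun n, junta k g -> eps_far eps f g) ->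
          2%:R / 3%:R <= prob_reject (tester n k eps rho) f
      & (query_complexity (tester n k eps rho))%:R <=
          C * (k%:R * ln (k.+1)%:R / (eps * rho * (1 - rho) ^+ k))].
Proof.
have [tester testerP] : exists tester : forall n : nat, nat -> R -> R -> ralg R n,
    forall n k eps rho, (1 <= k)%N -> 0 < eps < 1 -> 0 < rho < 1 ->
      is_junta_tester k eps rho (tester n k eps rho).
  (* The tester is a total function, so a trivial algorithm fills in outside the parameter range
     before [cid] makes the choice. *)
  have ex n k (eps rho : R) : exists A : ralg R n,
      (1 <= k)%N -> 0 < eps < 1 -> 0 < rho < 1 -> is_junta_tester k eps rho A.
    have [k1|k0] := boolP (1 <= k)%N; last by exists (Output R n true).
    have [e01|e0] := boolP (0 < eps < 1); last by exists (Output R n true).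
    have [r01|r0] := boolP (0 < rho < 1); last by exists (Output R n true).
    by have [A AP] := junta_tester n k1 e01 r01; exists A.
  exists (fun n k eps rho => projT1 (cid (ex n k eps rho))) => n k eps rho.
  exact: projT2 (cid (ex n k eps rho)).
exists 7684; first by rewrite ltr0n.
exists tester; exact: testerP.
Qed.
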